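(* Let $G\in\mathbb{R}^{n\times n}$ and let $\tilde{G}$ be the entrywise absolute value of $G$, $\tilde{G}_{uv}=|G_{uv}|$. Suppose $\rho(\tilde{G})<1$. Let $z\in\mathbb{R}^n$, let $x$ be the solution of $x=Gx+z$, and fix $i$. Let $(u_0,u_1,u_2,\dots)$ be any sequence in $\{1,\dots,n\}$ in which every coordinate appears infinitely often, and let $\hat{x}_i^{(t)}$ be the estimate after applying the asynchronous update tasks for $u_0,\dots,u_{t-1}$ starting from $\hat{x}_i^{(0)}=0$, $r^{(0)}=e_i$. Then $\hat{x}_i^{(t)}\to x_i$ as $t\to\infty$.
   Context: $\rho$ denotes spectral radius and $e_i$ the $i$-th standard basis vector. An asynchronous update task on coordinate $u$ transforms the pair $(\hat{x}_i,r)$ by: $\hat{x}_i\leftarrow\hat{x}_i+r_uz_u$, $r_u\leftarrow G_{uu}r_u$, and $r_v\leftarrow r_v+G_{uv}r_u$ for each $v\neq u$, where $r_u$ denotes the value before the task (equivalently $r\leftarrow r-(I-G^T)e_ur_u$). *)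

(* Defs.v *)
From mathcomp Require Import all_boot all_order all_algebra.
From mathcomp Require Import complex.
From mathcomp Require Import all_classical all_reals all_analysis.

Set Implicit Arguments.
Unset Strict Implicit.
Unset Printing Implicit Defensive.

Import Order.TTheory GRing.Theory Num.Theory.
Import numFieldNormedType.Exports.

Local Open Scope classical_set_scope.
Local Open Scope ring_scope.

(* Eigenvalues are taken in the complex field R[i]. MathComp's [eigenvalue]
   uses left (row) eigenvectors, which gives the same set of scalars. *)
Definition eigenvalue_moduli (R : realType) (n : nat) (A : 'M[R]_n) : set R :=
  [set Normc.normc l | l in
     [set l : R[i] | eigenvalue (map_mx (real_complex R) A) l]].

Definition spectral_radius (R : realType) (n : nat) (A : 'M[R]_n) : R :=
  sup (eigenvalue_moduli A).

(* The supremum is not the library's default value 0. *)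
Lemma has_sup_eigenvalue_moduli (R : realType) (n : nat) (A : 'M[R]_n) :
  (0 < n)%N -> has_sup (eigenvalue_moduli A).
Proof.
move=> n_gt0; set B := map_mx (real_complex R) A.
have [s defp] := closed_field_poly_normal (char_poly B).
have eigE l : eigenvalue B l = (l \in s).
  rewrite eigenvalue_root_char defp rootZ ?root_prod_XsubC //.
  by rewrite lead_coef_eq0 monic_neq0 ?char_poly_monic.
have : (0 < size s)%N.
  have := size_char_poly B; rewrite defp (monicP (char_poly_monic B)) scale1r.
  by rewrite size_prod_XsubC => -[->].
case: s => // l s in defp eigE * => _; split.
  by exists (Normc.normc l); exists l => //=; rewrite eigE mem_head.
exists (\sum_(k <- l :: s) Normc.normc k) => _ [k /= + <-].
rewrite eigE => ks; rewrite (big_rem k) //= lerDl sumr_ge0 // => -[a b] _.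
exact: sqrtr_ge0.
Qed.

Definition abs_mx (R : realType) (n : nat) (G : 'M[R]_n) : 'M[R]_n :=
  \matrix_(u, v) `|G u v|.

(* A state is a pair (estimate, residual vector). *)
Definition async_update (R : realType) (n : nat) (G : 'M[R]_n) (z : 'cV[R]_n)
    (u : 'I_n) (s : R * 'cV[R]_n) : R * 'cV[R]_n :=
  let: (xhat, r) := s in
  (xhat + r u ord0 * z u ord0,
   \col_v (if v == u then G u u * r u ord0
           else r v ord0 + G u v * r u ord0)).

Lemma async_update_residualE (R : realType) (n : nat) (G : 'M[R]_n)
    (z : 'cV[R]_n) (u : 'I_n) (xhat : R) (r : 'cV[R]_n) :
  (async_update G z u (xhat, r)).2
  = r - r u ord0 *: ((1%:M - G^T) *m delta_mx u ord0).
Proof.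
apply/colP => v; rewrite -colE !mxE; case: eqVneq => [->|_] /=.
  by rewrite mulrBr mulr1 opprB addrC subrK mulrC.
by rewrite sub0r mulrN opprK mulrC.
Qed.

Fixpoint async_state (R : realType) (n : nat) (G : 'M[R]_n) (z : 'cV[R]_n)
    (i : 'I_n) (u : nat -> 'I_n) (t : nat) : R * 'cV[R]_n :=
  if t is t'.+1 then async_update G z (u t') (async_state G z i u t')
  else (0, delta_mx i ord0).

Definition async_estimate (R : realType) (n : nat) (G : 'M[R]_n)
    (z : 'cV[R]_n) (i : 'I_n) (u : nat -> 'I_n) (t : nat) : R :=
  (async_state G z i u t).1.

(* Main.v *)
Require Import Defs.
From mathcomp Require Import all_boot all_order all_algebra.
From mathcomp Require Import complex.
From mathcomp Require Import all_classical all_reals all_analysis.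
From mathcomp Require Import lra.
Import Order.TTheory GRing.Theory Num.Theory.
Import numFieldNormedType.Exports.
Local Open Scope classical_set_scope.
Local Open Scope ring_scope.

(** The quantity [xhat + r^T x] is invariant, so it suffices that [r] tends to
    [0]. Let [w] solve [w = 1 + |G| w]. If [w >= 0], the weighted norm
    [Phi r := \sum_v w_v |r_v|] drops by at least [|r_u|] at an update of [u],
    while every coordinate of [r] moves by at most [K |r_u|]. Comparing [r_v] at
    time [t] with its value at the next update of [v] gives
    [|r_v| <= K (Phi - lim Phi)], which tends to [0].

    That [w >= 0] follows from the spectral radius by deformation:
    [w(t) = (1 - t |G|)^-1 1] is continuous on [0, 1] since [1 / t] is not an
    eigenvalue, and its smallest entry starts at [1] and cannot vanish, because
    [w(t) >= 0] already implies [w(t) = 1 + t |G| w(t) >= 1]. *)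

Lemma continuous_neq0_gt0 (R : realType) (f : R -> R) (a b : R) :
  a <= b -> continuous f -> (forall t, a <= t <= b -> f t != 0) ->
  0 < f a -> 0 < f b.
Proof.
move=> ab cf f_neq0 fa; rewrite ltNge; apply/negP => fb.
have [|c] := @IVT R f a b 0 ab (continuous_subspaceT cf).
  by rewrite ge_min fb orbT le_max (ltW fa).
by rewrite in_itv /= => /f_neq0/eqP.
Qed.

Lemma continuous_bigmin (R : realType) (I : Type) (s : seq I) (c : R)
    (f : I -> R -> R) :
  (forall k, continuous (f k)) ->
  continuous (fun t => \big[Num.min/c]_(k <- s) f k t).
Proof.
move=> cf; elim: s => [|k s IHs] t.
  by under eq_fun do rewrite big_nil; exact: cvg_cst.
under eq_fun do rewrite big_cons.
by apply: (@continuous_min _ _ (f k)); [exact: cf | exact: IHs].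
Qed.

Lemma real_eigenvalue_le_spectral_radius (R : realType) (n : nat)
    (A : 'M[R]_n) (l : R) (v : 'rV[R]_n) :
  v != 0 -> v *m A = l *: v -> `|l| <= spectral_radius A.
Proof.
move=> v_neq0 vA.
(* A nonzero [v] forces [n > 0], so the set of eigenvalue moduli has a genuine supremum. *)
have n_gt0 : (0 < n)%N.
  by case: n A v v_neq0 {vA} => // A v; rewrite [v]thinmx0 eqxx.
apply: (sup_upper_bound (has_sup_eigenvalue_moduli A n_gt0)).
exists (real_complex R l); last by rewrite /= expr0n addr0 sqrtr_sqr.
apply/eigenvalueP; exists (map_mx (real_complex R) v).
  by rewrite -map_mxM vA map_mxZ.
by rewrite map_mx_eq0.
Qed.

(** A left kernel vector would be an eigenvector of [A] for [1 / t >= 1], above the spectral radius;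
    [t = 0] leaves the identity matrix. *)
Lemma det_sub_scale_neq0 (R : realType) (n : nat) (A : 'M[R]_n) (t : R) :
  spectral_radius A < 1 -> 0 <= t <= 1 -> \det (1%:M - t *: A) != 0.
Proof.
move=> rhoA /andP[t_ge0 t_le1]; apply/negP => /det0P[v v_neq0].
rewrite mulmxBr mulmx1 -scalemxAr => /subr0_eq vE.
have [t0|t_neq0] := eqVneq t 0.
  by move: v_neq0; rewrite vE t0 scale0r eqxx.
have vA : v *m A = t^-1 *: v by rewrite [in RHS]vE scalerA mulVf ?scale1r.
have := real_eigenvalue_le_spectral_radius _ _ _ _ _ v_neq0 vA.
have t_gt0 : 0 < t by rewrite lt_neqAle eq_sym t_neq0.
rewrite ger0_norm ?invr_ge0 // leNgt (lt_le_trans rhoA) //.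
by rewrite -[leLHS]invr1 lef_pV2 ?posrE.
Qed.

Lemma nonneg_resolvent_vector (R : realType) (n : nat) (A : 'M[R]_n) :
  (forall u v, 0 <= A u v) -> spectral_radius A < 1 ->
  exists2 w : 'cV[R]_n, (forall u, 0 <= w u ord0) & w = const_mx 1 + A *m w.
Proof.
move=> A_ge0 rhoA.
(* Cramer's rule over polynomials in [t]: [w(t) = y(t) / d(t)], so continuity in [t] is that of the
   polynomials [y] and [d]. *)
pose M : 'M[{poly R}]_n := 1%:M - 'X *: map_mx polyC A.
pose d := \det M.
have [y yM] : exists y : 'cV[{poly R}]_n, M *m y = d *: const_mx 1.
  by exists (\adj M *m const_mx 1); rewrite mulmxA mul_mx_adj mul_scalar_mx.
have ME t : map_mx (horner_eval t) M = 1%:M - t *: A.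
  apply/matrixP => u v; rewrite !mxE /horner_eval !hornerE.
  by case: (u == v); rewrite !hornerE.
have dE t : d.[t] = \det (1%:M - t *: A) by rewrite -ME det_map_mx.
have yE t u : (y u ord0).[t] = d.[t] + t * \sum_v A u v * (y v ord0).[t].
  move: yM => /(congr1 (map_mx (horner_eval t))); rewrite map_mxM ME.
  rewrite mulmxBl mul1mx -scalemxAl => /matrixP/(_ u ord0).
  rewrite !mxE /= /horner_eval !hornerE => /eqP; rewrite subr_eq => /eqP ->.
  by congr (_ + _ * _); apply: eq_bigr => v _; rewrite mxE.
(* As [d(0) = 1] and [d] has no zero on [0, 1], [y(t)] and [w(t)] have the same signs. *)
have d_gt0 t : 0 <= t <= 1 -> 0 < d.[t].
  move=> /andP[t_ge0 t_le1]; apply: (@continuous_neq0_gt0 R _ 0 t) => //.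
  - exact: continuous_horner.
  - move=> s /andP[s_ge0 s_t]; rewrite dE det_sub_scale_neq0 //.
    by rewrite s_ge0 (le_trans s_t).
  - by rewrite dE scale0r subr0 det1.
(* The default value [1] is positive, so [m t > 0] still means that all entries of [y(t)] are
   positive. *)
pose m t := \big[Num.min/1]_u (y u ord0).[t].
have y_pos t : 0 <= t <= 1 -> 0 <= m t -> forall u, 0 < (y u ord0).[t].
  move=> t01 m_ge0 u; rewrite yE ltr_pwDl ?d_gt0 //.
  rewrite mulr_ge0 ?sumr_ge0 //; first by case/andP: t01.
  move=> v _; rewrite mulr_ge0 // (le_trans m_ge0) //.
  exact: (bigmin_le _ v (fun v => (y v ord0).[t])).
have m1_gt0 : 0 < m 1.
  apply: (@continuous_neq0_gt0 R m 0 1) => //.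
  - by apply: continuous_bigmin => k; exact: continuous_horner.
  - move=> t t01; apply/eqP => mt0; have := ltxx (0 : R).
    rewrite -{2}mt0 => /negP; apply; apply: lt_bigmin => // u _.
    by apply: y_pos => //; rewrite mt0.
  - apply: lt_bigmin => // u _; rewrite yE mul0r addr0 d_gt0 //.
    by rewrite lexx ler01.
have t1 : 0 <= (1 : R) <= 1 by rewrite lexx ler01.
exists (\col_u ((y u ord0).[1] / d.[1])) => [u|].
  by rewrite mxE divr_ge0 // ltW ?d_gt0 // y_pos // ltW.
apply/colP => u; rewrite !mxE yE mul1r mulrDl divff ?gt_eqF ?d_gt0 //.
by rewrite mulr_suml; congr (_ + _); apply: eq_bigr => v _; rewrite mxE mulrA.
Qed.

(** Zeroing [r_u] first lets the diagonal and off-diagonal cases share the increment [G_uv r_u]. *)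
Lemma async_updateE (R : realType) (n : nat) (G : 'M[R]_n) (z : 'cV[R]_n)
    (u v : 'I_n) (s : R * 'cV[R]_n) :
  (async_update G z u s).2 v ord0
  = (if v == u then 0 else s.2 v ord0) + G u v * s.2 u ord0.
Proof. by case: s => a r; rewrite mxE; case: eqP => [->|]; rewrite ?add0r. Qed.

(** The residual loses [r_u (I - G^T) e_u], so [r^T x] loses [r_u e_u^T (I - G) x = r_u z_u],
    exactly what the estimate gains. *)
Lemma async_update_invariant (R : realType) (n : nat) (G : 'M[R]_n)
    (z x : 'cV[R]_n) (u : 'I_n) (s : R * 'cV[R]_n) :
  x = G *m x + z ->
  let s' := async_update G z u s in
  s'.1 + (s'.2^T *m x) ord0 ord0 = s.1 + (s.2^T *m x) ord0 ord0.
Proof.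
move=> hx; case: s => a r /=; rewrite -/(async_update G z u (a, r)).2.
have := async_update_residualE G z u a r => /= ->.
rewrite linearB linearZ /= trmx_mul linearB /= trmx1 trmxK trmx_delta.
rewrite mulmxBl -scalemxAl -mulmxA mulmxBl mul1mx.
have -> : x - G *m x = z by rewrite {1}hx addrAC subrr add0r.
by rewrite -rowE !mxE addrACA subrr addr0.
Qed.

Lemma async_update_dist (R : realType) (n : nat) (G : 'M[R]_n) (z : 'cV[R]_n)
    (u v : 'I_n) (s : R * 'cV[R]_n) :
  `|s.2 v ord0 - (async_update G z u s).2 v ord0|
  <= (1 + \sum_a \sum_b `|G a b|) * `|s.2 u ord0|.
Proof.
(* The double sum is a crude bound for every entry of [G]; the extra [1] pays for the removal of
   [r_u] when [v = u]. *)
have G_le : `|G u v| <= \sum_a \sum_b `|G a b|.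
  rewrite (bigD1 u) //= (bigD1 v) //= -addrA lerDl addr_ge0 ?sumr_ge0 // => a _.
  exact: sumr_ge0.
rewrite async_updateE; case: eqP G_le => [->|_] G_le.
  rewrite add0r (le_trans (ler_normB _ _)) // normrM mulrDl mul1r.
  by rewrite lerD2l ler_wpM2r.
rewrite opprD addrA subrr add0r normrN normrM ler_wpM2r //.
by rewrite (le_trans G_le) // lerDr.
Qed.

Definition weighted_norm (R : realType) (n : nat) (w r : 'cV[R]_n) : R :=
  \sum_v w v ord0 * `|r v ord0|.

(** The update removes [w_u |r_u|] and adds at most [\sum_v w_v |G_uv| |r_u|], which is
    [(w_u - 1) |r_u|] by row [u] of the equation for [w]. *)
Lemma async_update_weighted_norm (R : realType) (n : nat) (G : 'M[R]_n)
    (z w : 'cV[R]_n) (u : 'I_n) (s : R * 'cV[R]_n) :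
  (forall v, 0 <= w v ord0) -> w = const_mx 1 + abs_mx G *m w ->
  weighted_norm _ _ w (async_update G z u s).2 + `|s.2 u ord0|
  <= weighted_norm _ _ w s.2.
Proof.
move=> w_ge0 wE.
have wuE : w u ord0 = 1 + \sum_v `|G u v| * w v ord0.
  by rewrite {1}wE !mxE; congr (_ + _); apply: eq_bigr => v _; rewrite mxE.
rewrite /weighted_norm [leRHS](bigD1 u) //= wuE mulrDl mul1r -addrA.
rewrite [leLHS]addrC lerD2l.
rewrite [X in _ <= _ + X]big_mkcond /= mulr_suml -big_split /=.
apply: ler_sum => v _; rewrite async_updateE.
apply: (le_trans (ler_wpM2l (w_ge0 v) (ler_normD _ _))).
rewrite mulrDr [leLHS]addrC normrM mulrA [_ * `|G u v|]mulrC lerD2l.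
by case: eqP; rewrite ?normr0 ?mulr0.
Qed.

Lemma nonincreasing_weighted_norm (R : realType) (n : nat) (G : 'M[R]_n)
    (z w : 'cV[R]_n) (i : 'I_n) (u : nat -> 'I_n) :
  (forall v, 0 <= w v ord0) -> w = const_mx 1 + abs_mx G *m w ->
  nonincreasing_seq (fun t => weighted_norm _ _ w (async_state G z i u t).2).
Proof.
move=> w_ge0 wE; apply/nonincreasing_seqP => t.
apply: le_trans (async_update_weighted_norm _ _ G z w (u t) _ w_ge0 wE).
by rewrite lerDl.
Qed.

(** Each step moves [r_v] by at most [K] times the drop of the weighted norm, and the drops
    telescope. *)
Lemma async_residual_dist (R : realType) (n : nat) (G : 'M[R]_n)
    (z w : 'cV[R]_n) (i v : 'I_n) (u : nat -> 'I_n) (t k : nat) :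
  (forall v, 0 <= w v ord0) -> w = const_mx 1 + abs_mx G *m w ->
  let r t := (async_state G z i u t).2 in
  `|r t v ord0 - r (t + k)%N v ord0|
  <= (1 + \sum_a \sum_b `|G a b|)
     * (weighted_norm _ _ w (r t) - weighted_norm _ _ w (r (t + k)%N)).
Proof.
move=> w_ge0 wE /=; pose r t := (async_state G z i u t).2.
rewrite -/(r t) -/(r (t + k)%N); elim: k => [|k IHk].
  by rewrite addn0 !subrr normr0 mulr0.
rewrite addnS; set s := (t + k)%N in IHk *.
apply: (le_trans (ler_distD (r s v ord0) _ _)).
apply: (le_trans (lerD IHk (async_update_dist _ _ G z (u s) v _))).
rewrite -mulrDr ler_wpM2l //.
  by rewrite addr_ge0 ?sumr_ge0 // => a _; exact: sumr_ge0.
have := async_update_weighted_norm _ _ G z w (u s) (async_state G z i u s)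
    w_ge0 wE.
rewrite -/(r s) -[(async_update _ _ _ _).2]/(r s.+1); lra.
Qed.

Lemma async_residual_cvg0 (R : realType) (n : nat) (G : 'M[R]_n)
    (z : 'cV[R]_n) (i v : 'I_n) (u : nat -> 'I_n) :
  spectral_radius (abs_mx G) < 1 ->
  (forall (v : 'I_n) (N : nat), exists t : nat, (N <= t)%N /\ u t = v) ->
  (async_state G z i u t).2 v ord0 @[t --> \oo] --> (0 : R).
Proof.
move=> rhoG hu.
have [|w w_ge0 wE] := @nonneg_resolvent_vector R n (abs_mx G) _ rhoG.
  by move=> a b; rewrite mxE.
pose r t := (async_state G z i u t).2.
pose Phi t := weighted_norm _ _ w (r t).
have Phi_dec : nonincreasing_seq Phi by exact: nonincreasing_weighted_norm.
have Phi_cvg : cvgn Phi.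
  apply: nonincreasing_is_cvgn => //; exists 0 => _ [t _ <-].
  by apply: sumr_ge0 => a _; rewrite mulr_ge0.
set K := 1 + \sum_a \sum_b `|G a b|.
have K_ge1 : 1 <= K by rewrite lerDl sumr_ge0 // => a _; exact: sumr_ge0.
have r_le t : `|r t v ord0| <= K * (Phi t - limn Phi).
  (* Any update time [s >= t] of [v] serves: there [|r_v|] is at most the drop of [Phi] from [s] to
     [s + 1]. *)
  have [s [ts us]] := hu v t.
  have := async_residual_dist _ _ G z w i v u t (s - t) w_ge0 wE.
  rewrite subnKC // -/(r s) -/(r t) -/(Phi s) -/(Phi t) -/K => dist_le.
  have := async_update_weighted_norm _ _ G z w (u s) (async_state G z i u s)
    w_ge0 wE.
  rewrite us -/(r s) -us -[(async_update _ _ _ _).2]/(r s.+1) us.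
  rewrite -/(Phi s) -/(Phi s.+1) => rs_le.
  have lim_le := nonincreasing_cvgn_ge Phi_dec Phi_cvg s.+1.
  have rs_leK : `|r s v ord0| <= K * (Phi s - limn Phi).
    have rs_lim : `|r s v ord0| <= Phi s - limn Phi by lra.
    (* Since [K >= 1], this bound can carry the factor [K] too, and its sum with [dist_le]
       telescopes at [Phi s]. *)
    by rewrite (le_trans rs_lim) // ler_peMl // (le_trans _ rs_lim).
  rewrite -[r t v ord0](subrK (r s v ord0)) (le_trans (ler_normD _ _)) //.
  by rewrite (le_trans (lerD dist_le rs_leK)) // -mulrDr addrA subrK.
apply/norm_cvg0P.
apply: (@squeeze_cvgr _ _ _ _ (fun=> 0) (fun t => K * (Phi t - limn Phi))).
- by near=> t; rewrite normr_ge0 r_le.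
- exact: cvg_cst.
- rewrite -(mulr0 K) -[X in K * X](subrr (limn Phi)).
  by apply: cvgM; [exact: cvg_cst | apply: cvgB => //; exact: cvg_cst].
Unshelve. all: by end_near.
Qed.

Theorem theorem2 (R : realType) (n : nat) (G : 'M[R]_n)
    (hG : spectral_radius (abs_mx G) < 1)
    (z x : 'cV[R]_n) (hx : x = G *m x + z)
    (i : 'I_n) (u : nat -> 'I_n)
    (hu : forall (v : 'I_n) (N : nat), exists t : nat, (N <= t)%N /\ u t = v) :
  async_estimate G z i u t @[t --> \oo] --> x i ord0.
Proof.
pose r t := (async_state G z i u t).2.
have estE t :
    async_estimate G z i u t = x i ord0 - \sum_v r t v ord0 * x v ord0.
  have -> : \sum_v r t v ord0 * x v ord0 = ((r t)^T *m x) ord0 ord0.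
    by rewrite mxE; apply: eq_bigr => v _; rewrite mxE.
  apply/eqP; rewrite eq_sym subr_eq eq_sym; apply/eqP.
  (* The initial state [(0, e_i)] gives the invariant the value [x_i]. *)
  elim: t => [|t IHt].
    by rewrite /async_estimate /r /= add0r trmx_delta -rowE mxE.
  by rewrite -IHt /async_estimate /r; exact: async_update_invariant.
have r_cvg : \sum_v r t v ord0 * x v ord0 @[t --> \oo] --> \sum_v 0 * x v ord0.
  apply: cvg_big => [|v _]; first exact: add_continuous.
  by apply: cvgM; [exact: async_residual_cvg0 | exact: cvg_cst].
have := cvgB (cvg_cst (x i ord0)) r_cvg.
rewrite big1 ?subr0 => [|v _]; last by rewrite mul0r.
by rewrite (funext estE : async_estimate G z i u = _); exact.
Qed.
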